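(* Let $q$ be a prime power, let $\epsilon>0$, let $p\ge 2$ be an integer, and let $m\le n$ be positive integers. Let $Z$ be a random vector in $\mathbb{F}_q^n$ with distribution $P_Z$. Let $\mathcal{C}$ be drawn uniformly at random from the set $\mathscr{C}$ of all $[n,n-m]_q$ linear codes, and let $H=H_{\mathcal{C}}$ be a parity-check matrix of $\mathcal{C}$ (an $m\times n$ matrix over $\mathbb{F}_q$ of rank $m$ whose kernel is $\mathcal{C}$), chosen independently of $Z$ given $\mathcal{C}$. If $m\le H_p(Z)-p-\log_q(1/\epsilon)$, then $$\mathbb{E}_{\mathcal{C}\sim\mathscr{C}}\big[\Delta^{(m)}_p(P_{HZ})\big]\le\epsilon,$$ where $P_{HZ}$ is the distribution on $\mathbb{F}_q^m$ of $HZ$ for the fixed code $\mathcal{C}$.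
   Context: Rényi entropy (base $q$) of order $p\in(1,\infty)$: $H_p(Z)=\frac{1}{1-p}\log_q\sum_x P_Z(x)^p$. For $f:\mathbb{F}_q^m\to\mathbb{R}$, the normalized norm is $\|f\|_p=\big(q^{-m}\sum_{x\in\mathbb{F}_q^m}|f(x)|^p\big)^{1/p}$, and the $l_p$-smoothness of a distribution $P$ on $\mathbb{F}_q^m$ is $\Delta^{(m)}_p(P):=\|q^mP\|_p-1$. An $[n,k]_q$ linear code is a $k$-dimensional subspace of $\mathbb{F}_q^n$. *)

(* Defs.v *)
From HB Require Import structures.
From mathcomp Require Import all_boot all_order all_algebra.
From mathcomp Require Import reals exp.
Unset Strict Implicit. Unset Printing Implicit Defensive.
Import Order.TTheory GRing.Theory Num.Theory.
Local Open Scope ring_scope.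

Definition logb {R : realType} (b x : R) : R := ln x / ln b.

Definition is_distr {R : realType} {T : finType} (P : T -> R) : Prop :=
  (forall x, 0 <= P x) /\ \sum_(x : T) P x = 1.

Definition renyi {R : realType} {T : finType} (q : R) (p : nat) (P : T -> R) : R :=
  (1 - p%:R)^-1 * logb q (\sum_(x : T) P x ^+ p).

Definition nnorm {R : realType} (F : finFieldType) (m p : nat)
    (f : 'cV[F]_m -> R) : R :=
  ((#|F|%:R ^+ m)^-1 * \sum_(y : 'cV[F]_m) `|f y| ^+ p) `^ (p%:R^-1).

Definition smoothness {R : realType} (F : finFieldType) (m p : nat)
    (P : 'cV[F]_m -> R) : R :=
  @nnorm R F m p (fun y => #|F|%:R ^+ m * P y) - 1.

Definition pushH {R : realType} (F : finFieldType) (m n : nat)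
    (H : 'M[F]_(m, n)) (P : 'cV[F]_n -> R) : 'cV[F]_m -> R :=
  fun y => \sum_(z : 'cV[F]_n | H *m z == y) P z.

(* The set of all [n,k]_q linear codes: k-dimensional subspaces of F^n,
   each represented as the set of its (column) vectors; a subspace is
   the span of the rows (transposed) of some n x n matrix of rank k. *)
Definition lin_codes (F : finFieldType) (n k : nat) : {set {set 'cV[F]_n}} :=
  [set [set x : 'cV[F]_n | (x^T <= V)%MS] | V in [set V : 'M[F]_n | \rank V == k]].

Definition parity_check (F : finFieldType) (m n : nat)
    (H : 'M[F]_(m, n)) (C : {set 'cV[F]_n}) : Prop :=
  \rank H = m /\ forall x : 'cV[F]_n, (x \in C) = (H *m x == 0).

Arguments logb {R} b x.
Arguments renyi {R T} q p P.
Arguments nnorm {R F} m p f.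
Arguments smoothness {R F} m p P.
Arguments pushH {R F m n} H P.
Arguments parity_check {F m n} H C.

(* Main.v *)
(** Write S(z) for the P-mass of the coset z + C and W = q^m S, so that
    ||q^m P_(HZ)||_p^p = sum_z P(z) W(z)^(p-1).  Expand W^(p-1) into a sum over
    x_1, ..., x_(p-1) in C and average over C.  If x_(p-1) is outside the span
    of the previous x_i, it lies in C with conditional probability at most
    q^-m, and this part contributes at most E W^(p-2).  If x_(p-1) is a given
    linear combination of the others, Cauchy-Schwarz inside a coset bounds the
    contribution by that of the zero combination, which is
    E sum_z P(z) (q^m P(z)) W(z)^(p-2).  There are q^(p-2) combinations, so
    with U = 1 + q^(p-2) q^m P one gets E W^(p-1) <= E (U W^(p-2)), hence
    E W^(p-1) <= E U^(p-1) by Young's inequality.  The Renyi condition bounds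
    the moments of P and gives E U^(p-1) <= (1 + eps)^(p-1); concavity of the
    p-th root concludes. *)

Require Import Defs.
From HB Require Import structures.
From mathcomp Require Import all_boot all_order all_algebra.
From mathcomp Require Import mxabelem lra ring.
From mathcomp Require Import reals exp.
Import Order.TTheory GRing.Theory Num.Theory.
Local Open Scope ring_scope.

(** * Young's inequality with integer exponents *)

(** Arithmetic-geometric mean inequality for [c] copies of [x ^+ N] and [d] copies of [y ^+ N],
    where [N] is [c + d]. *)
Lemma young_expr (R : realFieldType) (c d : nat) (x y : R) :
  0 <= x -> 0 <= y ->
  (c + d)%:R * (x ^+ c * y ^+ d) <= c%:R * x ^+ (c + d) + d%:R * y ^+ (c + d).
Proof.
move=> x0 y0; have [->|N0] := eqVneq (c + d)%N 0%N.
  by rewrite mul0r !expr0 addr_ge0 ?mulr_ge0 ?ler0n.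
set N := (c + d)%N in N0 *.
have lt0N : 0 < N%:R :> R by rewrite ltr0n lt0n.
pose E (i : 'I_N) := if (i < c)%N then x ^+ N else y ^+ N.
have split_ord (S : Type) (idx : S) (op : Monoid.com_law idx) (a b : S) :
    \big[op/idx]_(i < N) (if (i < c)%N then a else b) =
    op (\big[op/idx]_(i < c) a) (\big[op/idx]_(i < d) b).
  rewrite big_split_ord /=.
  congr (op _ _); first by apply: eq_bigr => i _; rewrite ltn_ord.
  by apply: eq_bigr => i _; rewrite ltnNge leq_addr.
have E_ge0 : {in 'I_N, forall i, 0 <= E i}.
  by move=> i _; rewrite /E; case: ifP => _; rewrite exprn_ge0.
have [+ _] := leif_AGM E_ge0; rewrite card_ord.
have -> : \prod_(i in 'I_N) E i = (x ^+ c * y ^+ d) ^+ N.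
  rewrite (eq_bigl predT) // /E split_ord.
  by rewrite !prodr_const !card_ord exprMn -!exprM ![(N * _)%N]mulnC.
have -> : \sum_(i in 'I_N) E i = c%:R * x ^+ N + d%:R * y ^+ N.
  rewrite (eq_bigl predT) // /E split_ord.
  by rewrite !sumr_const !card_ord !mulr_natl.
move=> H; rewrite mulrC -ler_pdivlMr //.
have lhs_ge0 : 0 <= x ^+ c * y ^+ d by rewrite mulr_ge0 ?exprn_ge0.
rewrite -(@ler_pXn2r _ N) ?lt0n ?nnegrE //.
by rewrite divr_ge0 ?addr_ge0 ?mulr_ge0 ?exprn_ge0.
Qed.

(** * Counting the codes that contain given vectors *)

Lemma lin_codesP (F : finFieldType) (n k : nat) (C : {set 'cV[F]_n}) :
  reflect (exists2 V : 'M[F]_n, \rank V = k & forall x, (x \in C) = (x^T <= V)%MS)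
          (C \in lin_codes F n k).
Proof.
apply: (iffP imsetP) => [[V] | [V rV CV]].
  by rewrite inE => /eqP rV ->; exists V => // x; rewrite inE.
by exists V; [rewrite inE rV | apply/setP => x; rewrite inE CV].
Qed.

Lemma lin_code_card (F : finFieldType) (n k : nat) (C : {set 'cV[F]_n}) :
  C \in lin_codes F n k -> #|C| = (#|F| ^ k)%N.
Proof.
case/lin_codesP => V <- CV; rewrite -card_rowg -(card_imset _ trmx_inj).
apply: eq_card => u; rewrite inE; apply/imsetP/idP => [[x + ->]|uV].
  by rewrite CV.
by exists u^T; rewrite ?CV trmxK.
Qed.

Lemma lin_code_preim (F : finFieldType) (n k : nat) (A : 'M[F]_n)
    (C : {set 'cV[F]_n}) :
  A \in unitmx -> C \in lin_codes F n k ->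
  [set x | A *m x \in C] \in lin_codes F n k.
Proof.
move=> uA /lin_codesP[V rV CV]; apply/lin_codesP.
have uAT : A^T \in unitmx by rewrite unitmx_tr.
exists (V *m invmx A^T); first by rewrite mxrankMfree // row_free_unit unitmx_inv.
by move=> x; rewrite inE CV trmx_mul -[in RHS](mulmxK uAT x^T) submxMfree //
  row_free_unit unitmx_inv.
Qed.

(** The conditioning event: the vectors already chosen lie in the code. They are stored as rows of
    [M], so that their span is a row space; codes consist of columns, hence the transposes. *)
Definition codes_above (F : finFieldType) (n k r : nat) (M : 'M[F]_(r, n)) :
    {set {set 'cV[F]_n}} :=
  [set C in lin_codes F n k | [forall i, (row i M)^T \in C]].

Lemma rows_in_code (F : finFieldType) (n r : nat) (M : 'M[F]_(r, n))
    (V : 'M[F]_n) (C : {set 'cV[F]_n}) :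
  (forall x, (x \in C) = (x^T <= V)%MS) ->
  [forall i, (row i M)^T \in C] = (M <= V)%MS.
Proof.
move=> CV; apply/forallP/row_subP => MV i; by have := MV i; rewrite CV trmxK.
Qed.

(** Appending [u] or [v] to a basis of the row space of [M] gives two independent families of the
    same size, and the map taking one to the other extends to an invertible matrix. *)
Lemma row_complement_transitive (F : finFieldType) (n r : nat)
    (M : 'M[F]_(r, n)) (u v : 'rV[F]_n) :
  ~~ (u <= M)%MS -> ~~ (v <= M)%MS ->
  exists2 A : 'M[F]_n, A \in unitmx & M *m A = M /\ u *m A = v.
Proof.
move=> uM vM; pose B := row_base M.
have rk (w : 'rV[F]_n) : ~~ (w <= M)%MS -> row_free (col_mx B w).
  move=> wM; rewrite /row_free -addsmxE.
  have w0 : w != 0 by apply: contraNneq wM => ->; exact: sub0mx.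
  have /mxdirect_addsP : (B :&: w)%MS = 0.
    apply/eqP; rewrite -mxrank_eq0; apply: contraNT wM; rewrite -lt0n => cap.
    have : (w <= B :&: w)%MS.
      rewrite -(geq_leqif (mxrank_leqif_sup (capmxSr B w))).
      by rewrite rank_rV w0.
    by move=> /submx_trans; apply; rewrite (submx_trans (capmxSl _ _)) ?eq_row_base.
  move/mxdirectP => /= ->.
  by rewrite eq_row_base rank_rV w0.
pose f := pinvmx (col_mx B u) *m col_mx B v.
have Uf : col_mx B u *m f = col_mx B v by rewrite mulmxA mulmxVp ?mul1mx ?rk.
have rkUf : \rank (col_mx B u *m f) = \rank (col_mx B u).
  by rewrite Uf; move/rk/eqP: uM => ->; move/rk/eqP: vM => ->.
have [A uA] := complete_unitmx rkUf; rewrite Uf mul_col_mx => /eq_col_mx[eB ev].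
exists A => //; split => //.
have /submxP[D ->] : (M <= B)%MS by rewrite eq_row_base.
by rewrite -mulmxA -eB.
Qed.

(* By transitivity of the stabiliser of the row space of M, the number of codes
   through M and y is the same for all y outside that space; count the pairs
   (y, C) in two ways. *)
Lemma codes_above_add (F : finFieldType) (n m r : nat) (M : 'M[F]_(r, n))
    (x : 'cV[F]_n) :
  (m <= n)%N -> ~~ (x^T <= M)%MS ->
  (#|F| ^ m * #|[set C in codes_above F n (n - m) r M | x \in C]|
     <= #|codes_above F n (n - m) r M|)%N.
Proof.
move=> mn xM.
set T := codes_above _ _ _ _ _.
pose N (y : 'cV[F]_n) := #|[set C in T | y \in C]|.
have N_le y z : ~~ (y^T <= M)%MS -> ~~ (z^T <= M)%MS -> (N y <= N z)%N.
  move=> yM zM; have [A uA [MA zA]] := row_complement_transitive _ _ _ _ _ _ zM yM.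
  have uAT : A^T \in unitmx by rewrite unitmx_tr.
  have zy : A^T *m z = y by apply: trmx_inj; rewrite trmx_mul trmxK.
  (* Since [A^T] fixes the rows of [M] and sends [z] to [y], taking preimages injects the codes
     through [y] into those through [z]. *)
  pose g (C : {set 'cV[F]_n}) := [set w | A^T *m w \in C].
  have g_inj : injective g.
    move=> C D /setP CD; apply/setP => w; have := CD (invmx A^T *m w).
    by rewrite !inE mulKVmx.
  rewrite /N -(card_imset _ g_inj); apply: subset_leq_card.
  apply/subsetP => _ /imsetP[C + ->]; rewrite !inE zy => /andP[/andP[CC /forallP MC] ->].
  rewrite lin_code_preim //= andbT; apply/forallP => i.
  by rewrite inE -trmx_mul -row_mul MA.
have N_eq y : ~~ (y^T <= M)%MS -> N y = N x.
  by move=> yM; apply/eqP; rewrite eqn_leq !N_le.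
pose S := [set y : 'cV[F]_n | (y^T <= M)%MS].
have cardS : #|~: S| = (#|F| ^ n - #|S|)%N.
  by rewrite cardsCs setCK card_mx muln1.
have dc : (#|~: S| * N x = #|T| * (#|F| ^ (n - m) - #|S|))%N.
  transitivity (\sum_(y in ~: S) \sum_(C in T) (y \in C))%N.
    rewrite -sum_nat_const; apply: eq_bigr => y; rewrite !inE => /N_eq <-.
    by rewrite /N -sum1dep_card big_mkcondr.
  rewrite exchange_big /= -sum_nat_const; apply: eq_bigr => C.
  rewrite inE => /andP[CC MC].
  rewrite -(lin_code_card _ _ _ _ CC) -big_mkcondr /= sum1dep_card.
  have SC : S \subset C.
    have /lin_codesP[V _ CV] := CC; apply/subsetP => y; rewrite inE CV => yM.
    by apply: submx_trans yM _; rewrite -(rows_in_code _ _ _ M V C CV).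
  rewrite -{2}(setIidPr SC) -cardsD; apply: eq_card => y; by rewrite !inE.
have S_lt : (0 < #|~: S|)%N by apply/card_gt0P; exists x; rewrite !inE.
(* With s the size of [S], what remains is q^m (q^(n-m) - s) <= q^n - s, which holds because s <=
   q^m s. *)
rewrite -(leq_pmul2l S_lt) mulnCA dc cardS.
rewrite mulnCA [X in (_ <= X)%N]mulnC leq_mul2l; apply/orP; right.
rewrite mulnBr -expnD subnKC // leq_sub2l // leq_pmull // expn_gt0.
by rewrite (ltnW (card_finNzRing_gt1 F)).
Qed.

(** * Coset masses of a fixed code *)

Definition lin_closed (F : finFieldType) (n : nat) (C : {set 'cV[F]_n}) : Prop :=
  0 \in C /\ forall a x y, x \in C -> y \in C -> a *: x + y \in C.

Lemma lin_code_closed (F : finFieldType) (n k : nat) (C : {set 'cV[F]_n}) :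
  C \in lin_codes F n k -> lin_closed _ _ C.
Proof.
case/lin_codesP => V _ CV; split=> [|a x y]; rewrite !CV ?trmx0 ?sub0mx //.
by move=> xV yV; rewrite linearP /= addmx_sub ?scalemx_sub.
Qed.

Lemma lin_closed_sum (F : finFieldType) (n : nat) (C : {set 'cV[F]_n}) (I : finType)
    (Q : pred I) (a : I -> F) (f : I -> 'cV[F]_n) :
  lin_closed _ _ C -> (forall i, f i \in C) -> \sum_(i | Q i) a i *: f i \in C.
Proof.
by move=> [C0 CP] Cf; elim/big_rec: _ => // i x _; apply: CP.
Qed.

Lemma lin_closed_addr (F : finFieldType) (n : nat) (C : {set 'cV[F]_n}) x y :
  lin_closed _ _ C -> x \in C -> (y + x \in C) = (y \in C).
Proof.
move=> [C0 CP] Cx; apply/idP/idP => H; last by rewrite -(scale1r y) CP.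
by have := CP (- 1) _ _ Cx H; rewrite scaleN1r addrC addrK.
Qed.

Lemma lin_closed_opp (F : finFieldType) (n : nat) (C : {set 'cV[F]_n}) x :
  lin_closed _ _ C -> (- x \in C) = (x \in C).
Proof.
move=> CL; have CN y : y \in C -> - y \in C.
  by move=> Cy; have := CL.2 (-1) _ _ Cy CL.1; rewrite scaleN1r addr0.
by apply/idP/idP => [/CN|/CN //]; rewrite opprK.
Qed.

Definition coset_mass (R : realType) (F : finFieldType) (n : nat)
    (P : 'cV[F]_n -> R) (C : {set 'cV[F]_n}) (z : 'cV[F]_n) : R :=
  \sum_(x in C) P (z + x).

Arguments coset_mass {R F n} P C z.

Lemma coset_mass_shift (R : realType) (F : finFieldType) (n : nat)
    (P : 'cV[F]_n -> R) (C : {set 'cV[F]_n}) z x :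
  lin_closed _ _ C -> x \in C -> coset_mass P C (z + x) = coset_mass P C z.
Proof.
move=> CL Cx; rewrite /coset_mass [RHS](reindex_inj (addIr x)) /=.
apply: eq_big => [y|y _]; first by rewrite lin_closed_addr.
by rewrite -addrA (addrC x).
Qed.

Lemma coset_mass_exp (R : realType) (F : finFieldType) (n r : nat)
    (P : 'cV[F]_n -> R) (C : {set 'cV[F]_n}) z :
  coset_mass P C z ^+ r =
  \sum_(f : {ffun 'I_r -> 'cV[F]_n} | f \in ffun_on (mem C)) \prod_i P (z + f i).
Proof.
by rewrite -(bigA_distr_big _ (fun _ x => P (z + x))) prodr_const card_ord.
Qed.

(* If a b != 0, then f b |-> sum_i a i f i is a bijection of C for fixed other
   f i, so 2 P(u) P(v) <= P(u)^2 + P(v)^2 applied to u = z + f b and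
   v = z + sum_i a i f i gives twice the same sum. *)
Lemma dependent_mass (R : realType) (F : finFieldType) (n r : nat)
    (P : 'cV[F]_n -> R) (C : {set 'cV[F]_n}) (a : 'I_r -> F) :
  (forall z, 0 <= P z) -> lin_closed _ _ C ->
  \sum_z P z * \sum_(f : {ffun 'I_r -> 'cV[F]_n} | f \in ffun_on (mem C))
      (\prod_i P (z + f i)) * P (z + \sum_i a i *: f i)
  <= \sum_z P z ^+ 2 * coset_mass P C z ^+ r.
Proof.
move=> P0 CL.
have [/existsP[b ab]|/existsPn a0] := boolP [exists b, a b != 0]; last first.
  (* For the zero combination the extra factor is [P z] itself, and both sides agree. *)
  apply: ler_sum => z _; rewrite expr2 -mulrA ler_wpM2l //.
  rewrite coset_mass_exp mulr_sumr; apply: ler_sum => f _.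
  rewrite [X in z + X]big1 ?addr0 1?mulrC // => i _.
  by have := a0 i; rewrite negbK => /eqP ->; rewrite scale0r.
pose G z (f : {ffun 'I_r -> 'cV[F]_n}) :=
  (\prod_(i | i != b) P (z + f i)) * P (z + f b) ^+ 2.
pose h (f : {ffun 'I_r -> 'cV[F]_n}) :=
  [ffun i => if i == b then \sum_i a i *: f i else f i].
have h_inj : injective h.
  move=> f g /ffunP fg.
  have off i : i != b -> f i = g i.
    by move=> ib; have := fg i; rewrite !ffunE (negPf ib).
  apply/ffunP => i; have [->|] := eqVneq i b; last exact: off.
  have := fg b; rewrite !ffunE eqxx (bigD1 b) //= [RHS](bigD1 b) //=.
  rewrite (eq_bigr (fun i => a i *: g i)); last by move=> j /off ->.
  by move/addIr/(scalerI ab).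
have h_on f : f \in ffun_on (mem C) -> h f \in ffun_on (mem C).
  move=> /ffun_onP fC; apply/ffun_onP => i; rewrite ffunE.
  by case: ifP => _; [exact: lin_closed_sum | exact: fC].
have G0 z f : 0 <= G z f by rewrite mulr_ge0 ?exprn_ge0 ?prodr_ge0.
pose Q z := \sum_(x in C) P (z + x) ^+ 2.
have sumG z : \sum_(f in ffun_on (mem C)) G z f = coset_mass P C z ^+ r.-1 * Q z.
  pose E i x := if i == b then P (z + x) ^+ 2 else P (z + x).
  transitivity (\sum_(f in ffun_on (mem C)) \prod_(i < r) E i (f i)).
    apply: eq_bigr => f _; rewrite (bigD1 b) //= /E eqxx mulrC; congr (_ * _).
    by apply: eq_bigr => i /negPf ->.
  rewrite -(bigA_distr_big _ E) (bigD1 b) //= mulrC {2}/E eqxx; congr (_ * _).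
  rewrite (eq_bigr (fun=> coset_mass P C z)); last first.
    by move=> i /negPf ib; apply: eq_bigr => x _; rewrite /E ib.
  by rewrite prodr_const cardC1 card_ord.
have le_z z : \sum_(f in ffun_on (mem C))
      (\prod_i P (z + f i)) * P (z + \sum_i a i *: f i) <=
    coset_mass P C z ^+ r.-1 * Q z.
  rewrite -sumG -(ler_pM2l (ltr0Sn R 1)) mulr_sumr.
  apply: (@le_trans _ _ (\sum_(f in ffun_on (mem C)) (G z f + G z (h f)))).
    apply: ler_sum => f _.
    have -> : G z (h f) =
        (\prod_(i | i != b) P (z + f i)) * P (z + \sum_i a i *: f i) ^+ 2.
      rewrite /G [h f b]ffunE eqxx; congr (_ * _).
      by apply: eq_bigr => i /negPf ib; rewrite [h f i]ffunE ib.
    rewrite /G (bigD1 b) //=.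
    set A := \prod_(i | _) _.
    rewrite -mulrDr [P _ * A]mulrC -mulrA mulrCA ler_wpM2l ?prodr_ge0 //.
    have := sqr_ge0 (P (z + f b) - P (z + \sum_i a i *: f i)); nra.
  rewrite big_split /= mulr_natl mulr2n lerD2l.
  rewrite [leRHS](reindex_inj h_inj) /= big_mkcond [leRHS]big_mkcond /=.
  apply: ler_sum => f _; case: ifP => [/h_on -> //|_]; case: ifP => // _.
apply: (@le_trans _ _ (\sum_z P z * (coset_mass P C z ^+ r.-1 * Q z))).
  by apply: ler_sum => z _; rewrite ler_wpM2l.
have r_gt0 : (0 < r)%N by exact: leq_ltn_trans (leq0n b) (ltn_ord b).
(* Replace [z] by [z - x]: the coset mass is unchanged and the square becomes [P z ^+ 2]. Summing
   the remaining [P (z - x)] over [C] supplies the missing factor of the coset mass. *)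
under eq_bigr do rewrite mulrA mulr_sumr.
rewrite exchange_big /=.
under eq_bigr => x Cx.
  rewrite (reindex_inj (addIr (- x))) /=.
  under eq_bigr do rewrite subrK coset_mass_shift ?lin_closed_opp //.
  over.
rewrite exchange_big /= le_eqVlt; apply/orP; left; apply/eqP.
apply: eq_bigr => z _; rewrite -!mulr_suml mulrC; congr (_ * _).
rewrite -[in RHS](prednK r_gt0) exprS; congr (_ * _).
rewrite /coset_mass (reindex_inj oppr_inj) /=.
by apply: eq_big => [x|x _]; rewrite ?lin_closed_opp ?opprK.
Qed.

(** * Averaging over codes: the recursion on moments *)

(** After exchanging the sums, each [x] outside the span is weighted by the number of codes through
    [M] and [x], at most a fraction q^-m of those through [M]; the weights [P x] sum to at most
    one. *)
Lemma independent_mass (R : realType) (F : finFieldType) (n m r : nat)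
    (P : 'cV[F]_n -> R) (M : 'M[F]_(r, n)) :
  (m <= n)%N -> is_distr P ->
  #|F|%:R ^+ m * \sum_(C in codes_above F n (n - m) r M)
      \sum_(x in C | ~~ (x^T <= M)%MS) P x
  <= #|codes_above F n (n - m) r M|%:R.
Proof.
move=> mn [P0 P1]; set T := codes_above _ _ _ _ _.
rewrite (exchange_big_dep (fun x : 'cV[F]_n => ~~ (x^T <= M)%MS)) /=; last first.
  by move=> C x _ /andP[].
have -> : #|T|%:R = \sum_x #|T|%:R * P x :> R by rewrite -mulr_sumr P1 mulr1.
rewrite mulr_sumr [leRHS](bigID (fun x => ~~ (x^T <= M)%MS)) /=.
apply: ler_wpDr; first by apply: sumr_ge0 => x _; rewrite mulr_ge0.
apply: ler_sum => x xM.
rewrite (eq_bigl [in [set C in T | x \in C]]) => [|C]; last by rewrite !inE xM andbT.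
rewrite sumr_const -[P x *+ _]mulr_natr mulrCA -natrX -natrM mulrC ler_wpM2r // ler_nat.
exact: codes_above_add.
Qed.

(** Lets a sum over a span be bounded by a sum over coefficient vectors, even when several of these
    give the same point. *)
Lemma sum_le_span (R : realType) (I J : finType) (g : I -> J) (Q : pred J) (P : J -> R) :
  (forall x, 0 <= P x) -> (forall x, Q x -> exists i, x = g i) ->
  \sum_(x | Q x) P x <= \sum_i P (g i).
Proof.
move=> P0 Qg; rewrite [leRHS](partition_big g predT) //= big_mkcond /=.
apply: ler_sum => x _; case: ifP => [/Qg[i xi]|_]; last exact: sumr_ge0.
by rewrite (bigD1 i) ?xi //= ler_wpDr ?sumr_ge0.
Qed.

(** The last of the [r.+1] vectors is split off and sorted by whether it lies in the span of the
    first [r], recorded by [f]. Outside the span [independent_mass] applies to [P] translated by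
    [z]. *)
Lemma coset_mass_step (R : realType) (F : finFieldType) (n m r : nat)
    (P : 'cV[F]_n -> R) (z : 'cV[F]_n) :
  (m <= n)%N -> is_distr P ->
  #|F|%:R ^+ m * \sum_(C in lin_codes F n (n - m)) coset_mass P C z ^+ r.+1 <=
  \sum_(C in lin_codes F n (n - m)) coset_mass P C z ^+ r +
  #|F|%:R ^+ m * \sum_(C in lin_codes F n (n - m)) \sum_(a : 'rV[F]_r)
    \sum_(f : {ffun 'I_r -> 'cV[F]_n} | f \in ffun_on (mem C))
      (\prod_i P (z + f i)) * P (z + \sum_i a 0 i *: f i).
Proof.
move=> mn [P0 P1]; set T := lin_codes _ _ _; set Q := _ ^+ m.
have Q0 : 0 <= Q by rewrite exprn_ge0.
pose M (f : {ffun 'I_r -> 'cV[F]_n}) := \matrix_i (f i)^T.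
pose Pi (f : {ffun 'I_r -> 'cV[F]_n}) := \prod_i P (z + f i).
have Pi0 f : 0 <= Pi f by exact: prodr_ge0.
have T_on f C : (C \in codes_above F n (n - m) r (M f)) =
    (C \in T) && (f \in ffun_on (mem C)).
  rewrite inE; congr (_ && _); apply/forallP/ffun_onP => H i;
    by have := H i; rewrite rowK trmxK.
have span_le f C : \sum_(x in C | (x^T <= M f)%MS) P (z + x) <=
    \sum_(a : 'rV[F]_r) P (z + \sum_i a 0 i *: f i).
  apply: (sum_le_span _ _ _ (fun a : 'rV[F]_r => \sum_i a 0 i *: f i) _ (fun x => P (z + x))) => //.
  move=> x /andP[_ /submxP[a xa]]; exists a; apply: trmx_inj.
  by rewrite xa mulmx_sum_row linear_sum; apply: eq_bigr => i _; rewrite linearZ rowK.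
have swap (G : {ffun 'I_r -> 'cV[F]_n} -> {set 'cV[F]_n} -> R) :
    \sum_(C in T) \sum_(f : {ffun 'I_r -> 'cV[F]_n} | f \in ffun_on (mem C)) G f C =
    \sum_f \sum_(C in codes_above F n (n - m) r (M f)) G f C.
  rewrite (exchange_big_dep predT) //=; apply: eq_bigr => f _.
  by apply: eq_bigl => C; rewrite T_on.
have indep_le :
    Q * \sum_(C in T) \sum_(f : {ffun 'I_r -> 'cV[F]_n} | f \in ffun_on (mem C))
      Pi f * \sum_(x in C | ~~ (x^T <= M f)%MS) P (z + x) <=
    \sum_(C in T) coset_mass P C z ^+ r.
  under [leRHS]eq_bigr do rewrite coset_mass_exp.
  rewrite !swap mulr_sumr; apply: ler_sum => f _.
  rewrite -mulr_sumr mulrCA sumr_const -[Pi f *+ _]mulr_natr ler_wpM2l //.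
  apply: (independent_mass _ _ _ _ _ (fun x => P (z + x))) => //; split=> //.
  by rewrite -P1 [RHS](reindex_inj (addrI z)).
rewrite -lerBlDr; apply: le_trans indep_le; rewrite lerBlDr -mulrDr ler_wpM2l //.
rewrite -big_split; apply: ler_sum => C _ /=.
rewrite exchange_big /= -big_split /= exprSr coset_mass_exp mulr_suml.
apply: ler_sum => f _; rewrite -mulr_sumr -mulrDr ler_wpM2l ?Pi0 //.
by rewrite /coset_mass (bigID (fun x => (x^T <= M f)%MS)) /= addrC lerD2l.
Qed.

(** Sum [coset_mass_step] over [z] with weight [P z]. The bound of [dependent_mass] is the same for
    all q^r coefficient vectors [a], whence the factor [#|F|%:R ^+ r]. *)
Lemma coset_moment_le (R : realType) (F : finFieldType) (n m r : nat)
    (P : 'cV[F]_n -> R) (T := lin_codes F n (n - m)) (Q : R := #|F|%:R ^+ m) :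
  (m <= n)%N -> is_distr P ->
  \sum_(C in T) \sum_z P z * (Q * coset_mass P C z) ^+ r.+1 <=
  \sum_(C in T) \sum_z
     P z * ((1 + #|F|%:R ^+ r * (Q * P z)) * (Q * coset_mass P C z) ^+ r).
Proof.
move=> mn Pd; have [P0 _] := Pd.
have Q0 : 0 <= Q by rewrite exprn_ge0.
rewrite exchange_big /=.
have -> : \sum_z \sum_(C in T) P z * (Q * coset_mass P C z) ^+ r.+1 =
    Q ^+ r * \sum_z P z * (Q * \sum_(C in T) coset_mass P C z ^+ r.+1).
  rewrite mulr_sumr; apply: eq_bigr => z _; rewrite -mulr_sumr mulrCA; congr (_ * _).
  by rewrite !mulr_sumr; apply: eq_bigr => C _; rewrite exprMn exprSr mulrA.
have -> : \sum_(C in T) \sum_z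
      P z * ((1 + #|F|%:R ^+ r * (Q * P z)) * (Q * coset_mass P C z) ^+ r) =
    Q ^+ r * (\sum_z P z * \sum_(C in T) coset_mass P C z ^+ r +
      Q * \sum_(C in T) #|F|%:R ^+ r * \sum_z P z ^+ 2 * coset_mass P C z ^+ r).
  under [X in _ * (X + _)]eq_bigr do rewrite mulr_sumr.
  rewrite [X in _ = _ * (X + _)]exchange_big /= [X in _ * (_ + X)]mulr_sumr -big_split /= mulr_sumr.
  apply: eq_bigr => C _; rewrite !mulr_sumr. rewrite -big_split mulr_sumr /=.
  by apply: eq_bigr => z _; rewrite exprMn; ring.
rewrite ler_wpM2l ?exprn_ge0 //.
apply: (@le_trans _ _ (\sum_z P z * (\sum_(C in T) coset_mass P C z ^+ r +
  Q * \sum_(C in T) \sum_(a : 'rV[F]_r)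
    \sum_(f : {ffun 'I_r -> 'cV[F]_n} | f \in ffun_on (mem C))
      (\prod_i P (z + f i)) * P (z + \sum_i a 0 i *: f i)))).
  by apply: ler_sum => z _; rewrite ler_wpM2l // coset_mass_step.
under eq_bigr do rewrite mulrDr mulrCA.
rewrite big_split /= lerD2l -mulr_sumr ler_wpM2l //.
under [leLHS]eq_bigr do rewrite mulr_sumr.
rewrite [leLHS]exchange_big /=; apply: ler_sum => C CT.
under [leLHS]eq_bigr do rewrite mulr_sumr.
rewrite [leLHS]exchange_big /=.
apply: (@le_trans _ _ (\sum_(a : 'rV[F]_r) \sum_z P z ^+ 2 * coset_mass P C z ^+ r)).
  apply: ler_sum => a _; apply: (dependent_mass _ _ _ _ P C (fun i => a 0 i)) => //.
  exact: lin_code_closed CT.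
by rewrite sumr_const card_mx mul1n -natrX mulr_natl.
Qed.

(** * Moment bounds *)

(* Young's inequality against the constant h, weighted by P: this is
   the monotonicity of Renyi entropies in multiplicative form. *)
Lemma moment_le (R : realType) (T : finType) (P : T -> R) (k j : nat) (h : R) :
  is_distr P -> 0 < h -> (0 < k)%N -> (j <= k)%N ->
  \sum_x P x ^+ k.+1 <= h ^+ k -> \sum_x P x ^+ j.+1 <= h ^+ j.
Proof.
move=> [P0 P1] h0 k0 jk Pk.
have kR : 0 < k%:R :> R by rewrite ltr0n.
have hk0 : 0 < h ^+ (k - j) by rewrite exprn_gt0.
rewrite -(ler_pM2r hk0) -exprD subnKC // -(ler_pM2l kR).
have -> : k%:R * h ^+ k = j%:R * h ^+ k + (k - j)%:R * h ^+ k.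
  by rewrite -mulrDl -natrD subnKC.
apply: (@le_trans _ _ (j%:R * \sum_x P x ^+ k.+1 + (k - j)%:R * h ^+ k)); last first.
  by rewrite lerD2r ler_wpM2l.
have -> : (k - j)%:R * h ^+ k = \sum_x P x * ((k - j)%:R * h ^+ k).
  by rewrite -mulr_suml P1 mul1r.
rewrite mulr_suml !mulr_sumr -big_split; apply: ler_sum => x _ /=.
have := young_expr _ j (k - j) _ _ (P0 x) (ltW h0); rewrite subnKC // => Y.
rewrite !exprS -[P x * _ * _]mulrA mulrCA [j%:R * _]mulrCA -mulrDr.
by rewrite ler_wpM2l.
Qed.

(** Expand both powers by the binomial theorem and compare term by term with [moment_le]. *)
Lemma affine_moment_le (R : realType) (T : finType) (P : T -> R) (k : nat) (h c : R) :
  is_distr P -> 0 < h -> 0 <= c -> (0 < k)%N ->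
  \sum_x P x ^+ k.+1 <= h ^+ k ->
  \sum_x P x * (1 + c * P x) ^+ k <= (1 + c * h) ^+ k.
Proof.
move=> Pd h0 c0 k0 Pk.
under eq_bigr do rewrite exprDn mulr_sumr.
rewrite exchange_big exprDn; apply: ler_sum => i _ /=.
under eq_bigr do rewrite expr1n mul1r mulrnAr exprMn mulrCA -exprS.
rewrite expr1n mul1r sumrMnl -mulr_sumr exprMn lerMn2r; apply/orP; right.
rewrite ler_wpM2l ?exprn_ge0 //.
by apply: moment_le Pk => //; rewrite -ltnS.
Qed.

Lemma sum_coset_moment_le (R : realType) (F : finFieldType) (n m r : nat)
    (P : 'cV[F]_n -> R) (h : R) (T := lin_codes F n (n - m)) (Q : R := #|F|%:R ^+ m) :
  (m <= n)%N -> is_distr P -> 0 < h -> \sum_x P x ^+ r.+2 <= h ^+ r.+1 ->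
  \sum_(C in T) \sum_z P z * (Q * coset_mass P C z) ^+ r.+1 <=
  #|T|%:R * (1 + #|F|%:R ^+ r * Q * h) ^+ r.+1.
Proof.
move=> mn Pd h0 Ph; have [P0 _] := Pd.
have Q0 : 0 <= Q by rewrite exprn_ge0.
pose W C z := Q * coset_mass P C z.
have W0 C z : 0 <= W C z by rewrite mulr_ge0 // sumr_ge0.
pose U z := 1 + #|F|%:R ^+ r * Q * P z.
have U0 z : 0 <= U z by rewrite addr_ge0 // !mulr_ge0 ?exprn_ge0.
have U_le : \sum_(C in T) \sum_z P z * U z ^+ r.+1 <=
    #|T|%:R * (1 + #|F|%:R ^+ r * Q * h) ^+ r.+1.
  rewrite sumr_const -[leLHS]mulr_natl ler_wpM2l //.
  by apply: affine_moment_le => //; rewrite mulr_ge0 ?exprn_ge0.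
apply: le_trans U_le; rewrite -/(W _ _).
have B_le := coset_moment_le _ _ _ _ r _ mn Pd.
set B := \sum_(C in T) _ in B_le *; set D := \sum_(C in T) _.
(* Young's inequality (r+1) U W^r <= U^(r+1) + r W^(r+1) brings [B] back on the right with
   coefficient [r], so it can be absorbed on the left. *)
have Y : r.+1%:R * B <= D + r%:R * B.
  apply: (@le_trans _ _ (r.+1%:R * \sum_(C in T) \sum_z P z * (U z * W C z ^+ r))).
    rewrite ler_wpM2l //.
    suff -> : \sum_(C in T) \sum_z P z * (U z * W C z ^+ r) =
      \sum_(C in T) \sum_z P z * ((1 + #|F|%:R ^+ r * (Q * P z)) *
        (Q * coset_mass P C z) ^+ r) by [].
    by apply: eq_bigr => C _; apply: eq_bigr => z _; rewrite /U -[_ * Q * _]mulrA.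
  rewrite !mulr_sumr -big_split; apply: ler_sum => C _ /=.
  rewrite !mulr_sumr -big_split; apply: ler_sum => z _ /=.
  rewrite mulrCA [r%:R * _]mulrCA -mulrDr ler_wpM2l //.
  by have := young_expr _ 1 r _ _ (U0 z) (W0 C z); rewrite add1n mul1r expr1.
by move: Y; rewrite -natr1 mulrDl mul1r addrC lerD2r.
Qed.

(** * From moments to smoothness and Rényi entropy *)

(** The fibres of [H] are the cosets of [C]. One of the [k.+1] factors [pushH H P y] is unfolded
    over its fibre and becomes the weight [P z]; the normalization cancels its [Q]. *)
Lemma smoothness_moment (R : realType) (F : finFieldType) (n m k : nat)
    (P : 'cV[F]_n -> R) (C : {set 'cV[F]_n}) (H : 'M[F]_(m, n)) (Q : R := #|F|%:R ^+ m) :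
  (forall z, 0 <= P z) -> parity_check H C ->
  smoothness m k.+1 (pushH H P) =
  (\sum_z P z * (Q * coset_mass P C z) ^+ k) `^ (k.+1%:R^-1) - 1.
Proof.
move=> P0 [_ HC]; rewrite /smoothness /nnorm; congr (_ `^ _ - 1).
have Q0 : 0 < Q by rewrite exprn_gt0 // ltr0n; apply/card_gt0P; exists 0.
have massE z : coset_mass P C z = pushH H P (H *m z).
  rewrite /pushH [RHS](reindex_inj (addrI z)); apply: eq_bigl => x.
  by rewrite HC mulmxDr -[in RHS]subr_eq0 addrAC subrr add0r.
transitivity (\sum_y pushH H P y * (Q * pushH H P y) ^+ k).
  rewrite mulr_sumr; apply: eq_bigr => y _.
  rewrite ger0_norm ?mulr_ge0 ?(ltW Q0) ?sumr_ge0 // exprS mulrA mulrA.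
  by rewrite mulVf ?mul1r ?gt_eqF.
rewrite [RHS](partition_big (fun z => H *m z) predT) //=.
apply: eq_bigr => y _; rewrite {1}/pushH mulr_suml; apply: eq_bigr => z /eqP Hz.
by rewrite massE Hz.
Qed.

(** Concavity of the root in division-free form: its graph lies below the tangent at [t ^+ k.+1]. *)
Lemma root_tangent_le (R : realType) (k : nat) (a t : R) :
  0 <= a -> 0 <= t ->
  k.+1%:R * (a `^ (k.+1%:R^-1) * t ^+ k) <= a + k%:R * t ^+ k.+1.
Proof.
move=> a0 t0; have := young_expr _ 1 k _ _ (powR_ge0 a (k.+1%:R^-1)) t0.
have -> : (a `^ (k.+1%:R^-1)) ^+ (1 + k) = a.
  by rewrite -powR_mulrn ?powR_ge0 // -powRrM mulVf ?pnatr_eq0 // powRr1.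
by rewrite add1n mul1r.
Qed.

Lemma renyi_condition (R : realType) (T : finType) (q eps : R) (P : T -> R) (k m : nat) :
  1 < q -> 0 < eps -> is_distr P -> (0 < k)%N ->
  m%:R <= renyi q k.+1 P - k.+1%:R - logb q eps^-1 ->
  \sum_x P x ^+ k.+1 <= (eps / q ^+ (m + k.+1)) ^+ k.
Proof.
move=> q1 eps0 [P0 P1] k0; set S := \sum_x _ ^+ _ => cond.
have q0 : 0 < q by exact: lt_trans q1.
have lnq : 0 < ln q by exact: ln_gt0.
have h0 : 0 < eps / q ^+ (m + k.+1) by rewrite divr_gt0 ?exprn_gt0.
(* Logarithms require [S] to be positive; otherwise every [P x] would vanish. *)
have S0 : 0 < S.
  rewrite lt_def sumr_ge0 ?andbT => [|x _]; last exact: exprn_ge0.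
  apply/eqP => /psumr_eq0P SE; move/eqP: P1; rewrite big1 => [|x _].
    by rewrite eq_sym oner_eq0.
  have /eqP : P x ^+ k.+1 = 0 by apply: SE => // y _; exact: exprn_ge0.
  by rewrite expf_eq0 => /andP[_ /eqP].
rewrite -ler_ln ?posrE ?exprn_gt0 // lnXn // ln_div ?posrE ?exprn_gt0 // lnXn //.
move: cond; rewrite /renyi /logb -/S lnV ?posrE //.
have -> : 1 - k.+1%:R = - k%:R :> R by rewrite -natr1; ring.
have kR : 0 < k%:R :> R by rewrite ltr0n.
move: (ln S) (ln q) (ln eps) lnq => s l e l0.
rewrite -[(e - _) *+ k]mulr_natl -[l *+ _]mulr_natl natrD -natr1 => cond.
have -> : s = - ((- k%:R)^-1 * (s / l)) * (k%:R * l) by field; rewrite ?gt_eqF.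
have kl : 0 < k%:R * l by exact: mulr_gt0.
have -> : k%:R * (e - (m%:R + (k%:R + 1)) * l) =
   (e / l - m%:R - (k%:R + 1)) * (k%:R * l) by field; rewrite gt_eqF.
rewrite ler_pM2r //; move: cond; rewrite mulNr; lra.
Qed.

Theorem theorem3p1 (R : realType) (F : finFieldType) (eps : R) (p m n : nat)
    (P : 'cV[F]_n -> R) (Hc : {set 'cV[F]_n} -> 'M[F]_(m, n)) :
  0 < eps -> (2 <= p)%N -> (0 < m)%N -> (m <= n)%N ->
  is_distr P ->
  (forall C, C \in lin_codes F n (n - m) -> parity_check (Hc C) C) ->
  m%:R <= renyi (#|F|%:R) p P - p%:R - logb (#|F|%:R) eps^-1 ->
  (#|lin_codes F n (n - m)|%:R)^-1 *
    \sum_(C in lin_codes F n (n - m)) smoothness m p (pushH (Hc C) P) <= eps.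
Proof.
move=> eps0; case: p => [|[|r]] // _ _ mn Pd HcP cond.
have q1 : 1 < #|F|%:R :> R by rewrite ltr1n card_finNzRing_gt1.
have q0 : 0 < #|F|%:R :> R by exact: lt_trans q1.
set T := lin_codes _ _ _; set q : R := #|F|%:R in q1 q0 cond *.
have [P0 _] := Pd.
have [T0|T0] := posnP #|T|.
  (* For an empty family the average is 0, the inverse of 0 being 0. *)
  by rewrite T0 invr0 mul0r ltW.
have TR : 0 < #|T|%:R :> R by rewrite ltr0n.
have Ph := renyi_condition _ _ _ _ _ _ _ q1 eps0 Pd (ltn0Sn r) cond.
set h := eps / _ in Ph.
have h0 : 0 < h by rewrite divr_gt0 ?exprn_gt0.
(* Here p is [r.+2], so [h] is eps / q^(m+r+2) and a factor q^2 is to spare. *)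
have h_le : q ^+ r * q ^+ m * h <= eps.
  rewrite /h mulrCA -[leRHS]mulr1 ler_pM2l // ler_pdivrMr ?exprn_gt0 // mul1r.
  by rewrite -exprD ler_weXn2l ?ltW // addnC leq_add2l -addn2 leq_addr.
pose A C := \sum_z P z * (q ^+ m * coset_mass P C z) ^+ r.+1.
have A0 C : 0 <= A C.
  by rewrite sumr_ge0 // => z _; rewrite !mulr_ge0 ?exprn_ge0 ?mulr_ge0 ?exprn_ge0 ?sumr_ge0 // ltW.
pose t := 1 + eps.
have t0 : 0 < t by rewrite addr_gt0.
(* The moment bound yields exponent [r.+1]; it is weakened to [r.+2] to match the point where the
   tangent is taken. *)
have A_le : \sum_(C in T) A C <= #|T|%:R * t ^+ r.+2.
  apply: le_trans (sum_coset_moment_le _ _ _ _ _ _ _ mn Pd h0 Ph) _.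
  rewrite ler_wpM2l //; apply: (@le_trans _ _ (t ^+ r.+1)).
    have qh0 : 0 < q ^+ r * q ^+ m * h by apply: mulr_gt0 => //; rewrite -exprD exprn_gt0.
    by apply: lerXn2r; rewrite ?nnegrE ?lerD2l // ?(ltW t0) // addr_ge0 // ltW.
  by rewrite ler_weXn2l // lerDl ltW.
rewrite mulrC ler_pdivrMr //.
under eq_bigr => C CT do rewrite (smoothness_moment _ _ _ _ _ _ _ _ P0 (HcP C CT)) -/(A C).
rewrite sumrB sumr_const lerBlDr -[X in _ <= _ + X]mulr_natl mulr1.
(* Scaling by p t^(p-1) puts each root in the form of [root_tangent_le]; the total is then at most p
   t^p per code. *)
have ptk : 0 < r.+2%:R * t ^+ r.+1 by rewrite mulr_gt0 ?ltr0n ?exprn_gt0.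
rewrite -(ler_pM2r ptk) mulr_suml.
apply: (@le_trans _ _ (\sum_(C in T) (A C + r.+1%:R * t ^+ r.+2))).
  by apply: ler_sum => C _; rewrite mulrCA; exact: root_tangent_le (ltW t0).
rewrite big_split /= sumr_const -[_ *+ #|T|]mulr_natl.
apply: le_trans (lerD A_le (lexx _)) _; rewrite le_eqVlt; apply/orP; left; apply/eqP.
by rewrite /t exprS -[r.+2%:R]natr1; ring.
Qed.
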